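(* For every function $f:\mathbb{N}\to\mathbb{N}$ there is a graph $G$ such that $|G| = 2^{\aleph_1}$, $\chi(G)=\aleph_1$, and for every natural number $k\ge 3$ we have $f_G(k)\ge f(k)$; that is, every subgraph of $G$ with fewer than $f(k)$ vertices has chromatic number less than $k$.
   Context: Graphs are simple undirected graphs (no loops); $|G|$ denotes the number of vertices and $\chi(G)$ the chromatic number. For a graph $G$ with infinite chromatic number and $k\in\mathbb{N}$, $f_G(k)$ is the least natural number $m$ such that $G$ has a subgraph with $m$ vertices and chromatic number at least $k$ (this exists by the De Bruijn–Erdős compactness theorem). $\mathbb{N}$ includes $0$. *)

(* Defs.v *)
From Stdlib Require Import List Arith.
Import ListNotations.

Definition simple_graph {V : Type} (E : V -> V -> Prop) : Prop :=
  (forall x y, E x y -> E y x) /\ (forall x, ~ E x x).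

Definition proper_coloring {V C : Type} (E : V -> V -> Prop) (c : V -> C) : Prop :=
  forall x y, E x y -> c x <> c y.

Definition countable (A : Type) : Prop :=
  exists g : A -> nat, forall a b, g a = g b -> a = b.

Definition equinumerous (A B : Type) : Prop :=
  exists g : A -> B, (forall a b, g a = g b -> a = b) /\ (forall y, exists x, g x = y).

(* W has cardinality aleph_1: W carries a strict well-order (total) in which W is
   uncountable but every proper initial segment is countable (order type omega_1). *)
Definition has_card_aleph1 (W : Type) : Prop :=
  exists R : W -> W -> Prop,
    well_founded R /\
    (forall x y z, R x y -> R y z -> R x z) /\
    (forall x y, R x y \/ x = y \/ R y x) /\
    ~ countable W /\
    (forall w, countable {x : W | R x w}).

(* chi(V,E) = aleph_1, where W has cardinality aleph_1: a proper colouring with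
   aleph_1 colours exists, and none with countably many colours exists
   (every countable colour set injects into nat). *)
Definition chromatic_aleph1 {V : Type} (E : V -> V -> Prop) (W : Type) : Prop :=
  (exists c : V -> W, proper_coloring E c) /\
  ~ (exists c : V -> nat, proper_coloring E c).

(* A finite subgraph (vertex list s, edge relation E' contained in E restricted to s)
   has chromatic number < k, i.e. admits a proper colouring with k-1 colours. *)
Definition subgraph_of {V : Type} (E : V -> V -> Prop) (s : list V) (E' : V -> V -> Prop) : Prop :=
  NoDup s /\ (forall x y, E' x y -> E x y /\ In x s /\ In y s).

Definition colorable_with {V : Type} (E' : V -> V -> Prop) (s : list V) (n : nat) : Prop :=
  exists c : V -> nat, (forall x, In x s -> c x < n) /\ proper_coloring E' c.

(* Main.v *)
Require Import Defs.
From Stdlib Require Import List Arith Lia Cantor Wellfounded.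
From Stdlib Require Import Classical ClassicalEpsilon ProofIrrelevance.
From Stdlib Require Import FunctionalExtensionality PropExtensionality.
From mathcomp Require boolp wochoice.

Import ListNotations.

(** A vertex carries an increasing sequence [a] of countable ordinals and a binary sequence [x].
    Two vertices [(a, x)], [(b, y)] whose binary sequences first differ at [n] are joined when
    [a (2 i) < b i < a (2 i + 1)] for all [i < M n], or the same with [a] and [b] exchanged,
    where [M] grows fast depending on [f].

    Edges with first difference [n] form a bipartite graph, as [x n] colours it. Edges with first
    difference at least [n] form a graph without short odd closed walks: around a closed walk with
    more steps up than down the indices would be multiplied by at least 2, up to a bounded error.
    Hence a small subgraph is coloured by [n] bits plus one.

    Call a set of finite sequences large if "uncountably many first terms, uncountably many second
    terms, ..." lead into it; two large sets contain interlaced sequences. Given a proper colouring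
    by natural numbers and bits [p 0, ..., p (n - 1)], colour [n] is therefore small below one of
    the two extensions of [p]. Always moving to that extension gives some [x], and as countably
    many countable sets are bounded, there is an [a] such that [(a, x)] avoids every colour. *)

(** * Existence of omega_1 *)

(** The well-ordering principle gives a boolean relation [R] with unique minima. Minima of sets of
    two or three points yield totality, antisymmetry and transitivity; negating the converse of [R]
    makes the order strict. *)
Lemma total_well_order_exists (T : Type) :
  exists lt : T -> T -> Prop,
    well_founded lt /\
    (forall x y z, lt x y -> lt y z -> lt x z) /\
    (forall x y, lt x y \/ x = y \/ lt y x).
Proof.
  destruct (wochoice.well_ordering_principle
    (eqtype.Equality.Pack (eqtype.Equality.Class (boolp.gen_eqMixin T)))) as [R HR].
  assert (minimum : forall P : T -> Prop, (exists x, P x) ->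
    exists z, P z /\ (forall x, P x -> R z x = true) /\
      forall z', P z' -> (forall x, P x -> R z' x = true) -> z = z').
  { intros P [x Px].
    set (A := fun t : T => if excluded_middle_informative (P t) then true else false).
    assert (HA : forall t, A t = true <-> P t).
    { intro t; unfold A; destruct (excluded_middle_informative (P t)); intuition discriminate. }
    destruct (HR A) as [z [[Az Lz] Uz]].
    { exists x. apply HA, Px. }
    exists z; split; [apply HA, Az | split].
    - intros y Py. apply Lz, HA, Py.
    - intros z' Pz' Lz'. apply Uz. split; [apply HA, Pz' |].
      intros y Ay. apply Lz', HA, Ay. }
  assert (tot : forall x y, R x y = true \/ R y x = true).
  { intros x y. destruct (minimum (fun t => t = x \/ t = y)) as [z [[-> | ->] [Lz _]]]; eauto. }
  assert (anti : forall x y, R x y = true -> R y x = true -> x = y).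
  { intros x y Hxy Hyx.
    assert (refl : forall t, R t t = true) by (intro t; destruct (tot t t); assumption).
    destruct (minimum (fun t => t = x \/ t = y)) as [z [_ [_ U]]]; [eauto |].
    transitivity z.
    - symmetry; apply U; [auto | intros t [-> | ->]; auto].
    - apply U; [auto | intros t [-> | ->]; auto]. }
  exists (fun x y => R y x <> true). split; [| split].
  - intro x. apply NNPP. intro Nx.
    destruct (minimum (fun t => ~ Acc (fun x y => R y x <> true) t)) as [z [Nz [Lz _]]]; [eauto |].
    apply Nz. constructor. intros y Hy. apply NNPP. intro Ny. apply Hy, Lz, Ny.
  - intros x y z Hxy Hyz Hzx.
    destruct (minimum (fun t => t = x \/ t = y \/ t = z)) as [m [Hm [Lm _]]]; [eauto |].
    destruct Hm as [-> | [-> | ->]].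
    + assert (x = z) by (apply anti; auto). subst z.
      destruct (tot x y); auto.
    + apply Hxy, Lm; auto.
    + apply Hyz, Lm; auto.
  - intros x y. destruct (classic (R y x = true)) as [Hyx |]; [| auto].
    destruct (classic (R x y = true)) as [Hxy |]; [| auto].
    right; left. apply anti; assumption.
Qed.

Definition omega1_order {W : Type} (lt : W -> W -> Prop) : Prop :=
  well_founded lt /\
  (forall x y z, lt x y -> lt y z -> lt x z) /\
  (forall x y, lt x y \/ x = y \/ lt y x) /\
  ~ countable W /\
  (forall w, countable {x : W | lt x w}).

Lemma countable_injection_into (A B : Type) (h : A -> B) :
  (forall a b, h a = h b -> a = b) -> countable B -> countable A.
Proof.
  intros Hh [g Hg]. exists (fun a => g (h a)). auto.
Qed.

Lemma cantor_space_uncountable : ~ countable (nat -> bool).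
Proof.
  intros [g Hg].
  set (d := fun n => if excluded_middle_informative (exists x, g x = n /\ x n = true)
                     then false else true).
  assert (Hd : forall n, d n = true <-> ~ exists x, g x = n /\ x n = true).
  { intro n. unfold d. destruct (excluded_middle_informative _); intuition discriminate. }
  destruct (classic (d (g d) = true)) as [H | H].
  - apply (proj1 (Hd _) H). exists d. auto.
  - apply H, Hd. intros [x [Hx Ht]]. apply Hg in Hx. congruence.
Qed.

(** In a well-order of the Cantor space, the points with countably many predecessors form an initial
    segment. Were it countable, the least point outside would belong to it, or the Cantor space
    would be countable. *)
Lemma omega1_exists : exists (W : Type) (lt : W -> W -> Prop), omega1_order lt.
Proof.
  destruct (total_well_order_exists (nat -> bool)) as [lt [wf [trans tot]]].
  set (P := fun t => countable {x | lt x t}).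
  exists {t | P t}, (fun x y => lt (proj1_sig x) (proj1_sig y)).
  assert (eq_sig : forall x y : {t | P t}, proj1_sig x = proj1_sig y -> x = y).
  { intros [x Px] [y Py]; simpl; intros ->. f_equal. apply proof_irrelevance. }
  assert (down : forall x y, lt x y -> P y -> P x).
  { intros x y Hxy. apply countable_injection_into with
      (h := fun z : {z | lt z x} => exist (fun z => lt z y) (proj1_sig z)
              (trans _ _ _ (proj2_sig z) Hxy)).
    intros [a Ha] [b Hb] E. injection E as ->. f_equal. apply proof_irrelevance. }
  split; [| split; [| split; [| split]]].
  - apply (wf_inverse_image _ _ _ (@proj1_sig _ P) wf).
  - intros x y z. apply trans.
  - intros x y. destruct (tot (proj1_sig x) (proj1_sig y)) as [| [|]]; auto.
  - intro C. destruct (classic (exists t, ~ P t)) as [[t Nt] | all].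
    + (* The least point outside [P] would have [P] as its set of predecessors. *)
      revert Nt. induction t as [t IH] using (well_founded_induction wf). intro Nt.
      apply Nt. unfold P.
      assert (HP : forall x, lt x t -> P x) by (intros x Hx; apply NNPP; intro; eapply IH; eauto).
      revert C. apply countable_injection_into with
        (h := fun z : {z | lt z t} => exist P (proj1_sig z) (HP _ (proj2_sig z))).
      intros [a Ha] [b Hb] E. injection E as ->. f_equal. apply proof_irrelevance.
    + apply cantor_space_uncountable. revert C.
      assert (HP : forall x, P x) by (intros x; apply NNPP; eauto).
      apply countable_injection_into with (h := fun z => exist P z (HP z)).
      intros a b E. injection E as ->. reflexivity.
  - intros [w Pw]. simpl. revert Pw. unfold P.
    intro Pw. pose proof Pw as Pw'. revert Pw'. apply countable_injection_into with
      (h := fun z : {z : {t | P t} | lt (proj1_sig z) w} =>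
              exist (fun z => lt z w) (proj1_sig (proj1_sig z)) (proj2_sig z)).
    intros [a Ha] [b Hb] E. injection E as E. apply eq_sig in E. subst b.
    f_equal. apply proof_irrelevance.
Qed.

Lemma omega1_inhabited {W : Type} (lt : W -> W -> Prop) : omega1_order lt -> inhabited W.
Proof.
  intros (_ & _ & _ & unc & _). apply NNPP. intro N. apply unc.
  exists (fun _ => 0). intro w. exfalso. apply N. constructor. exact w.
Qed.

Lemma omega1_irrefl {W : Type} (lt : W -> W -> Prop) (w : W) : omega1_order lt -> ~ lt w w.
Proof.
  intros [wf _]. induction w as [w IH] using (well_founded_induction wf).
  intro H. exact (IH w H H).
Qed.

Lemma countable_segment_code {W : Type} (lt : W -> W -> Prop) (w : W) :
  countable {x | lt x w} ->
  exists h : W -> nat, forall x y, (lt x w \/ x = w) -> (lt y w \/ y = w) -> h x = h y -> x = y.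
Proof.
  intros [g Hg].
  (* The successor reserves code 0 for [w] itself. *)
  exists (fun x => match excluded_middle_informative (lt x w) with
                   | left H => S (g (exist _ x H)) | right _ => 0 end).
  intros x y Hx Hy.
  destruct (excluded_middle_informative (lt x w)) as [Lx | Lx];
  destruct (excluded_middle_informative (lt y w)) as [Ly | Ly]; try discriminate.
  - intro E. injection E as E. apply Hg in E. injection E as E. exact E.
  - intros _. destruct Hx, Hy; subst; tauto.
Qed.

(** Otherwise the closed segments below the [g n] cover [W], and a countable union of countable sets
    is countable. *)
Lemma omega1_sequence_bounded {W : Type} (lt : W -> W -> Prop) (g : nat -> W) :
  omega1_order lt -> exists w, forall n, lt (g n) w.
Proof.
  intros [_ [_ [tot [unc seg]]]]. apply NNPP. intro N. apply unc.
  assert (cof : forall w, exists n, lt w (g n) \/ w = g n).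
  { intro w. apply NNPP. intro Nw. apply N. exists w. intro n.
    destruct (tot (g n) w) as [| [|]]; [assumption | |]; exfalso; apply Nw; exists n; auto. }
  destruct (choice _ cof) as [r Hr].
  destruct (choice _ (fun n => countable_segment_code lt (g n) (seg (g n)))) as [h Hh].
  exists (fun w => Cantor.to_nat (r w, h (r w) w)).
  intros a b E. apply Cantor.to_nat_inj in E. injection E as E1 E2.
  apply (Hh (r a)); [apply Hr | rewrite E1; apply Hr | rewrite E1 at 2; exact E2].
Qed.

(** Vertices will be the subsets of [W * nat], so this product, and not only [W], has to be ordered
    in type omega_1. *)
Definition lex_nat {W : Type} (lt : W -> W -> Prop) (p q : W * nat) : Prop :=
  lt (fst p) (fst q) \/ (fst p = fst q /\ snd p < snd q).

Lemma omega1_lex_nat {W : Type} (lt : W -> W -> Prop) :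
  omega1_order lt -> omega1_order (lex_nat lt).
Proof.
  intros [wf [trans [tot [unc seg]]]]. unfold lex_nat.
  split; [| split; [| split; [| split]]].
  - intros [w n]. revert n. induction w as [w IHw] using (well_founded_induction wf).
    intro n. induction n as [n IHn] using (well_founded_induction Nat.lt_wf_0).
    constructor. intros [v m]. simpl. intros [H | [-> H]]; auto.
  - intros [x i] [y j] [z k]; simpl. intros [H1 | [-> H1]] [H2 | [-> H2]]; eauto.
    right. split; [reflexivity | lia].
  - intros [x i] [y j]; simpl. destruct (tot x y) as [H | [-> | H]]; auto.
    destruct (Nat.lt_total i j) as [H | [-> | H]]; auto.
  - intro C. apply unc. revert C.
    apply countable_injection_into with (h := fun w => (w, 0)). congruence.
  - intros [w n]. destruct (countable_segment_code lt w (seg w)) as [h Hh].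
    exists (fun p => Cantor.to_nat (h (fst (proj1_sig p)), snd (proj1_sig p))).
    intros [[x i] Hx] [[y j] Hy] E. apply Cantor.to_nat_inj in E. simpl in *.
    injection E as E1 E2.
    assert (x = y) by (apply Hh; intuition). subst. f_equal. apply proof_irrelevance.
Qed.

(** * Finite graphs without short odd closed walks *)

Inductive walk {X : Type} (S : X -> X -> Prop) : nat -> X -> X -> Prop :=
| walk_nil x : walk S 0 x x
| walk_cons n x y z : S x y -> walk S n y z -> walk S (1 + n) x z.

Lemma walk_app {X : Type} (S : X -> X -> Prop) m n x y z :
  walk S m x y -> walk S n y z -> walk S (m + n) x z.
Proof.
  induction 1; simpl; eauto using walk_cons.
Qed.

Lemma walk_sym {X : Type} (S : X -> X -> Prop) n x y :
  (forall x y, S x y -> S y x) -> walk S n x y -> walk S n y x.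
Proof.
  intro sym. induction 1 as [| n x y z Hxy _ IH]; [constructor |].
  replace (1 + n) with (n + 1) by lia.
  apply walk_app with y; [exact IH |].
  apply (walk_cons S 0 y x x); [auto | constructor].
Qed.

Lemma walk_points {X : Type} (S : X -> X -> Prop) n x y :
  walk S n x y ->
  exists p : nat -> X, p 0 = x /\ p n = y /\ forall i, i < n -> S (p i) (p (1 + i)).
Proof.
  induction 1 as [x | n x y z Hxy _ (p & <- & Hn & Hp)].
  - exists (fun _ => x). repeat split; lia.
  - exists (fun i => match i with 0 => x | Datatypes.S i => p i end).
    repeat split; [exact Hn |]. intros [| i] Hi; simpl; [exact Hxy | apply Hp; lia].
Qed.

Lemma walk_of_points {X : Type} (S : X -> X -> Prop) (p : nat -> X) n i :
  (forall j, i <= j < i + n -> S (p j) (p (1 + j))) -> walk S n (p i) (p (i + n)).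
Proof.
  revert i. induction n as [| n IH]; intros i Hp.
  - rewrite Nat.add_0_r. constructor.
  - apply (walk_cons S n _ (p (1 + i))); [apply Hp; lia |].
    replace (i + Datatypes.S n) with ((1 + i) + n) by lia.
    apply IH. intros j Hj. apply Hp. lia.
Qed.

Lemma pigeonhole_repetition {X : Type} (s : list X) (p : nat -> X) n :
  (forall i, i < n -> In (p i) s) -> length s < n -> exists i j, i < j < n /\ p i = p j.
Proof.
  intros Hp Hn. apply NNPP. intro N.
  assert (ND : NoDup (map p (seq 0 n))).
  { apply NoDup_map_NoDup_ForallPairs; [| apply seq_NoDup].
    intros i j Hi Hj E. apply in_seq in Hi, Hj.
    destruct (Nat.lt_total i j) as [H | [H | H]]; [| exact H |]; exfalso; apply N.
    - exists i, j. split; [lia | exact E].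
    - exists j, i. split; [lia | symmetry; exact E]. }
  apply (NoDup_incl_length (l' := s)) in ND.
  - rewrite length_map, length_seq in ND. lia.
  - intros y Hy. apply in_map_iff in Hy as [i [<- Hi]]. apply in_seq in Hi. apply Hp. lia.
Qed.

(** A closed walk longer than [length s] repeats a vertex and splits there into two shorter closed
    walks, one of them odd. *)
Lemma odd_closed_walk_shorten {X : Type} (S : X -> X -> Prop) (s : list X) n x :
  (forall x y, S x y -> In x s /\ In y s) ->
  Nat.Odd n -> walk S n x x ->
  exists m y, Nat.Odd m /\ m <= length s /\ walk S m y y.
Proof.
  intros Hs. revert x. induction n as [n IH] using (well_founded_induction Nat.lt_wf_0).
  intros x On Hw. destruct (Nat.le_gt_cases n (length s)) as [| Hlt]; [eauto |].
  destruct (walk_points S n x x Hw) as (p & P0 & Pn & Hp).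
  destruct (pigeonhole_repetition s p n) as (i & j & Hij & E); [| exact Hlt |].
  { intros i Hi. apply (Hs _ (p (1 + i))), Hp, Hi. }
  assert (W1 : walk S (j - i) (p i) (p i)).
  { rewrite E at 2. replace j with (i + (j - i)) at 2 by lia.
    apply walk_of_points. intros; apply Hp; lia. }
  assert (W2 : walk S (n - (j - i)) x x).
  { replace (n - (j - i)) with (i + (n - j)) by lia. apply walk_app with (p i).
    - rewrite <- P0. apply (walk_of_points S p i 0). intros; apply Hp; lia.
    - rewrite E, <- Pn. replace n with (j + (n - j)) at 2 by lia.
      apply walk_of_points. intros; apply Hp; lia. }
  destruct (Nat.Even_or_Odd (j - i)) as [Ev | Od].
  - apply (IH (n - (j - i))) with x; [lia | | exact W2].
    destruct On as [a Ha], Ev as [b Hb]. exists (a - b). lia.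
  - apply (IH (j - i)) with (p i); [lia | exact Od | exact W1].
Qed.

(** Each vertex is coloured by the parity of some walk from the root of its component; equal
    parities at the ends of an edge would close an odd walk through the root. *)
Lemma two_coloring_of_no_odd_closed_walk {X : Type} (S : X -> X -> Prop) :
  (forall x y, S x y -> S y x) ->
  (forall n x, Nat.Odd n -> ~ walk S n x x) ->
  exists c : X -> bool, proper_coloring S c.
Proof.
  intros sym no_odd.
  set (conn := fun x y => exists n, walk S n x y).
  assert (root_ex : exists r : X -> X,
            (forall x, conn (r x) x) /\ forall x y, S x y -> r x = r y).
  (* Neighbours have equal connectivity predicates, so [epsilon] picks the same root for both. *)
  { exists (fun x => epsilon (inhabits x) (fun y => conn y x)). split.
    - intro x. apply epsilon_spec. exists x, 0. constructor.
    - intros x y Hxy.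
      assert (E : (fun z => conn z x) = (fun z => conn z y)).
      { apply functional_extensionality. intro z. apply propositional_extensionality.
        split; intros [n Hn]; exists (n + 1).
        - apply walk_app with x; [exact Hn |]. apply (walk_cons S 0 x y y Hxy). constructor.
        - apply walk_app with y; [exact Hn |].
          apply (walk_cons S 0 y x x (sym _ _ Hxy)). constructor. }
      rewrite E. f_equal. apply proof_irrelevance. }
  destruct root_ex as [r [Hr Er]]. destruct (choice _ Hr) as [d Hd].
  exists (fun x => Nat.even (d x)). intros x y Hxy E.
  apply (no_odd (d x + (1 + d y)) (r x)).
  - apply Nat.odd_spec. rewrite Nat.odd_add, Nat.odd_add, <- !Nat.negb_even, E.
    destruct (Nat.even (d y)); reflexivity.
  - apply walk_app with x; [apply Hd |]. apply walk_cons with y; [exact Hxy |].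
    rewrite (Er _ _ Hxy). apply walk_sym; [exact sym | apply Hd].
Qed.

(** * Interlaced sequences *)

Definition increasing {W : Type} (lt : W -> W -> Prop) (a : nat -> W) : Prop :=
  forall i j, i < j -> lt (a i) (a j).

(* Every disjoint interlacing pattern is unavoidable in [omega_1]. The doubling of the
   index makes a single pattern, read to greater and greater depth [M], exclude longer and
   longer odd closed walks. *)
Definition interlaced {W : Type} (lt : W -> W -> Prop) (M : nat) (a b : nat -> W) : Prop :=
  forall i, i < M -> lt (a (2 * i)) (b i) /\ lt (b i) (a (2 * i + 1)).

Inductive updown_walk {W : Type} (lt : W -> W -> Prop) (M : nat) :
  nat -> nat -> (nat -> W) -> (nat -> W) -> Prop :=
| updown_nil a : updown_walk lt M 0 0 a a
| updown_up p q a b c : increasing lt a -> interlaced lt M a b ->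
    updown_walk lt M p q b c -> updown_walk lt M (1 + p) q a c
| updown_down p q a b c : increasing lt a -> interlaced lt M b a ->
    updown_walk lt M p q b c -> updown_walk lt M p (1 + q) a c.

Section ClosedWalks.

Context {W : Type} (lt : W -> W -> Prop).
Hypothesis lt_irrefl : forall w, ~ lt w w.
Hypothesis lt_trans : forall x y z, lt x y -> lt y z -> lt x z.

(* An up step doubles the index and a down step halves it, up to an additive loss that the
   terms [d] and [2 ^ (p + q) * (d + 1) - 1] keep track of. *)
Lemma updown_walk_index M p q a b : updown_walk lt M p q a b ->
  forall e c d, 2 ^ (e + p + q) * c + 2 ^ (p + q) * (d + 1) <= M ->
  lt (a (2 ^ (e + p) * c + d)) (b (2 ^ (e + q) * c + (2 ^ (p + q) * (d + 1) - 1))) \/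
  a (2 ^ (e + p) * c + d) = b (2 ^ (e + q) * c + (2 ^ (p + q) * (d + 1) - 1)).
Proof.
  assert (pos : forall k, 1 <= 2 ^ k) by (intro k; pose proof (Nat.pow_nonzero 2 k); lia).
  induction 1 as [a | p q a b c' Ha Hab _ IH | p q a b c' Ha Hba _ IH]; intros e c d HM.
  - right. f_equal. simpl. rewrite Nat.add_0_r. lia.
  - replace (e + (1 + p) + q) with (1 + (e + p + q)) in HM by lia.
    replace (1 + p + q) with (1 + (p + q)) in * by lia.
    replace (e + (1 + p)) with (1 + (e + p)) by lia.
    rewrite !Nat.pow_add_r, Nat.pow_1_r in *.
    rewrite <- !Nat.pow_add_r in *.
    (* The offset [2 * d + 1] is taken to agree with the down step; monotonicity of [a] absorbs the
       excess. *)
    specialize (IH e c (2 * d + 1)).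
    replace (2 ^ (p + q) * (2 * d + 1 + 1)) with (2 * 2 ^ (p + q) * (d + 1)) in IH by ring.
    pose proof (pos (p + q)). pose proof (pos (e + p + q)).
    assert (Hle : 2 ^ (e + p) <= 2 ^ (e + p + q)) by (apply Nat.pow_le_mono_r; lia).
    destruct (Hab (2 ^ (e + p) * c + (2 * d + 1))) as [Hlt _]; [nia |].
    assert (L : lt (a (2 * 2 ^ (e + p) * c + d)) (b (2 ^ (e + p) * c + (2 * d + 1)))).
    { apply lt_trans with (2 := Hlt). apply Ha. lia. }
    left. destruct IH as [IH | <-]; [nia | eapply lt_trans; eassumption | exact L].
  - replace (e + p + (1 + q)) with (1 + (e + p + q)) in HM by lia.
    replace (p + (1 + q)) with (1 + (p + q)) in * by lia.
    replace (e + (1 + q)) with (1 + e + q) by lia.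
    (* A down step gives [a i] below [b (2 * i + 1)], which raises [e] by one and turns [d] into
       [2 * d + 1]. *)
    specialize (IH (1 + e) c (2 * d + 1)).
    replace (1 + e + p + q) with (1 + (e + p + q)) in IH by lia.
    replace (2 ^ (1 + e + p) * c + (2 * d + 1)) with (2 * (2 ^ (e + p) * c + d) + 1) in IH
      by (simpl; ring).
    replace (2 ^ (p + q) * (2 * d + 1 + 1)) with (2 ^ (1 + (p + q)) * (d + 1)) in IH
      by (simpl; ring).
    pose proof (pos (1 + (p + q))).
    assert (Hle : 2 ^ (e + p) <= 2 ^ (1 + (e + p + q))) by (apply Nat.pow_le_mono_r; lia).
    destruct (Hba (2 ^ (e + p) * c + d)) as [_ Hlt]; [nia |].
    left. destruct IH as [IH | <-]; [exact HM | eapply lt_trans; eassumption | exact Hlt].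
Qed.

Lemma no_closed_walk_up M p q a :
  2 ^ (2 * (p + q) + 1) <= M -> q < p -> increasing lt a -> ~ updown_walk lt M p q a a.
Proof.
  intros HM Hqp Ha Hw.
  (* With [c = 2 ^ (p + q)] the surplus factor of 2 in [2 ^ p * c] over [2 ^ q * c] outweighs the
     loss [2 ^ (p + q) - 1], so a term of [a] would lie at or below an earlier one. *)
  pose proof (updown_walk_index M p q a a Hw 0 (2 ^ (p + q)) 0) as H.
  simpl (0 + _) in H. rewrite !Nat.mul_1_r, Nat.add_0_r in H.
  replace (2 * (p + q) + 1) with ((p + q) + (p + q) + 1) in HM by lia.
  rewrite !(Nat.pow_add_r 2 _ 1), (Nat.pow_add_r 2 (p + q) (p + q)) in HM.
  assert (1 <= 2 ^ (p + q)) by (pose proof (Nat.pow_nonzero 2 (p + q)); lia).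
  assert (1 <= 2 ^ q) by (pose proof (Nat.pow_nonzero 2 q); lia).
  assert (2 * 2 ^ q <= 2 ^ p) by (apply (Nat.pow_le_mono_r 2 (1 + q) p); lia).
  assert (Hlt : 2 ^ q * 2 ^ (p + q) + (2 ^ (p + q) - 1) < 2 ^ p * 2 ^ (p + q)) by nia.
  apply Ha in Hlt. destruct H as [H | H]; [simpl in HM; nia | |].
  - eapply lt_irrefl, lt_trans; eassumption.
  - rewrite H in Hlt. eapply lt_irrefl; eassumption.
Qed.

Lemma updown_walk_snoc_up M p q a b c : updown_walk lt M p q a b ->
  increasing lt b -> interlaced lt M b c -> updown_walk lt M (1 + p) q a c.
Proof.
  intros Hw Hb Hbc. induction Hw as [a | p q a b c' Ha Hab _ IH | p q a b c' Ha Hba _ IH].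
  - apply updown_up with c; [assumption | assumption | constructor].
  - apply updown_up with b; auto.
  - apply updown_down with b; auto.
Qed.

Lemma updown_walk_snoc_down M p q a b c : updown_walk lt M p q a b ->
  increasing lt b -> interlaced lt M c b -> updown_walk lt M p (1 + q) a c.
Proof.
  intros Hw Hb Hbc. induction Hw as [a | p q a b c' Ha Hab _ IH | p q a b c' Ha Hba _ IH].
  - apply updown_down with c; [assumption | assumption | constructor].
  - apply updown_up with b; auto.
  - apply updown_down with b; auto.
Qed.

(** Monotonicity is asked of the relation and not of the vertices: any sequence may then occur at a
    vertex, those not increasing being isolated. *)
Definition linked (M : nat) (a b : nat -> W) : Prop :=
  increasing lt a /\ increasing lt b /\ (interlaced lt M a b \/ interlaced lt M b a).

(** The reversed walk, with up and down exchanged, is carried along: when a closed walk has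
    [p <> q], one of the two directions has more steps up. *)
Lemma walk_updown {V : Type} (S : V -> V -> Prop) (s : V -> nat -> W) M n u v :
  (forall u v, S u v -> linked M (s u) (s v)) -> walk S n u v ->
  exists p q, p + q = n /\ updown_walk lt M p q (s u) (s v) /\
              updown_walk lt M q p (s v) (s u).
Proof.
  intro HS. induction 1 as [u | n u v w Huv _ (p & q & Hn & Hp & Hq)].
  - exists 0, 0. repeat split; constructor.
  - destruct (HS _ _ Huv) as (Hu & Hv & [H | H]).
    + exists (1 + p), q. split; [lia | split].
      * apply updown_up with (s v); assumption.
      * apply updown_walk_snoc_down with (s v); assumption.
    + exists p, (1 + q). split; [lia | split].
      * apply updown_down with (s v); assumption.
      * apply updown_walk_snoc_up with (s v); assumption.
Qed.

Lemma linked_no_odd_closed_walk {V : Type} (S : V -> V -> Prop) (s : V -> nat -> W) M L n u :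
  (forall u v, S u v -> linked M (s u) (s v)) ->
  2 ^ (2 * L + 1) <= M -> n <= L -> Nat.Odd n -> ~ walk S n u u.
Proof.
  intros HS HM HnL [k Hk] Hw.
  assert (Hu : increasing lt (s u)).
  { inversion Hw; subst; [lia |]. apply (HS u y). assumption. }
  destruct (walk_updown S s M n u u HS Hw) as (p & q & Hn & Hp & Hq).
  assert (2 ^ (2 * (p + q) + 1) <= 2 ^ (2 * L + 1)) by (apply Nat.pow_le_mono_r; lia).
  destruct (Nat.lt_total p q) as [H1 | [H1 | H1]]; [| lia |].
  - revert Hq. apply no_closed_walk_up; [replace (q + p) with (p + q) |..]; (assumption || lia).
  - revert Hp. apply no_closed_walk_up; (assumption || lia).
Qed.

Lemma linked_two_colorable {V : Type} (S : V -> V -> Prop) (s : V -> nat -> W) (l : list V) M :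
  (forall u v, S u v -> S v u) ->
  (forall u v, S u v -> In u l /\ In v l) ->
  (forall u v, S u v -> linked M (s u) (s v)) ->
  2 ^ (2 * length l + 1) <= M ->
  exists c : V -> bool, proper_coloring S c.
Proof.
  intros sym Hl HS HM. apply two_coloring_of_no_odd_closed_walk; [exact sym |].
  intros n x On Hw.
  destruct (odd_closed_walk_shorten S l n x Hl On Hw) as (m & y & Om & Hm & Hy).
  exact (linked_no_odd_closed_walk S s M (length l) m y HS HM Hm Om Hy).
Qed.

End ClosedWalks.

(** * Uncountable chromatic number *)

(** Unbounded means uncountable in omega_1, so these are the sets outside the [n]-fold Fubini power
    of the ideal of countable sets. *)
Fixpoint large {W : Type} (lt : W -> W -> Prop) (n : nat) (A : list W -> Prop) : Prop :=
  match n with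
  | 0 => A []
  | S n => forall w0, exists w, lt w0 w /\ large lt n (fun l => A (w :: l))
  end.

Lemma large_inhabited {W : Type} (lt : W -> W -> Prop) (d : W) n A :
  large lt n A -> exists l, A l.
Proof.
  revert A. induction n as [| n IH]; intros A H; [eauto |].
  destruct (H d) as [w [_ Hw]]. destruct (IH _ Hw) as [l Hl]. eauto.
Qed.

(** Terms are chosen alternately, each [b] above the last [a] and the next [a] above that [b]; the
    last [r] terms from [B] are arbitrary. *)
Lemma large_interlaced {W : Type} (lt : W -> W -> Prop) (d : W) r K A B :
  large lt (2 * K) A -> large lt (K + r) B ->
  exists la lb, A la /\ B lb /\
    forall i, i < K -> lt (nth (2 * i) la d) (nth i lb d) /\
                       lt (nth i lb d) (nth (2 * i + 1) la d).
Proof.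
  revert A B. induction K as [| K IH]; intros A B HA HB.
  - destruct (large_inhabited lt d _ _ HB) as [lb Hlb].
    exists [], lb. repeat split; [exact HA | exact Hlb | lia | lia].
  - replace (2 * S K) with (S (S (2 * K))) in HA by lia.
    destruct (HA d) as [a0 [_ HA0]]. destruct (HB a0) as [b0 [Hb0 HB0]].
    destruct (HA0 b0) as [a1 [Ha1 HA1]].
    destruct (IH _ _ HA1 HB0) as (la & lb & Hla & Hlb & Hi).
    exists (a0 :: a1 :: la), (b0 :: lb). split; [exact Hla | split; [exact Hlb |]].
    intros [| i] Hlt; [split; assumption |].
    replace (2 * S i) with (S (S (2 * i))) by lia. apply Hi. lia.
Qed.

Lemma increasing_course_of_values {W : Type} (lt : W -> W -> Prop) (F : list W -> W) (a : nat -> W) :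
  (forall l w, In w l -> lt w (F l)) ->
  (forall m, a m = F (map a (seq 0 m))) -> increasing lt a.
Proof.
  intros HF Ha i j Hij. rewrite (Ha j). apply HF, in_map, in_seq. lia.
Qed.

Lemma course_of_values {W : Type} (F : list W -> W) :
  exists a : nat -> W, forall m, a m = F (map a (seq 0 m)).
Proof.
  set (L := nat_rect (fun _ => list W) [] (fun _ l => l ++ [F l])).
  exists (fun m => F (L m)). intro m. f_equal.
  induction m as [| m IH]; [reflexivity |].
  rewrite seq_S, map_app, <- IH. reflexivity.
Qed.

Lemma small_sets_avoidable {W : Type} (lt : W -> W -> Prop) (N : nat -> nat)
    (A : nat -> list W -> Prop) :
  omega1_order lt -> (forall n, ~ large lt (N n) (A n)) ->
  exists a, increasing lt a /\ forall n, ~ A n (map a (seq 0 (N n))).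
Proof.
  intros Hlt HA.
  pose proof Hlt as [_ [trans _]].
  (* The invariant: no [A n] is large beyond the prefix [l]. For each [n] it forbids only a bounded
     set of next terms, and countably many bounds have a common upper bound. At length [N n] it says
     that [A n] is avoided. *)
  set (good := fun l => forall n, length l <= N n ->
         ~ large lt (N n - length l) (fun l' => A n (l ++ l'))).
  assert (step : forall l, exists w,
            (good l -> good (l ++ [w])) /\ forall y, In y l -> lt y w).
  { intro l.
    destruct (omega1_inhabited lt Hlt) as [d].
    assert (B : forall n, exists b, good l -> length l < N n -> forall w, lt b w ->
              ~ large lt (N n - S (length l)) (fun l' => A n (l ++ w :: l'))).
    { intro n. destruct (classic (good l /\ length l < N n)) as [[Hg Hn] |];
        [| exists d; tauto].
      apply NNPP. intro Nb. apply (Hg n); [lia |].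
      replace (N n - length l) with (S (N n - S (length l))) by lia.
      intro b. apply NNPP. intro Nw. apply Nb. exists b. intros _ _ w Hw Hl.
      apply Nw. exists w. auto. }
    destruct (choice _ B) as [b Hb].
    destruct (omega1_sequence_bounded lt b Hlt) as [w1 Hw1].
    (* Padding by [d] turns the list into a sequence, so that [w2] bounds all its entries. *)
    destruct (omega1_sequence_bounded lt (fun n => nth n l d) Hlt) as [w2 Hw2].
    destruct (omega1_sequence_bounded lt (fun n => match n with 0 => w1 | _ => w2 end) Hlt)
      as [w Hw].
    exists w. split.
    - intros Hg n Hn. rewrite length_app in *. simpl in Hn |- *.
      replace (N n - (length l + 1)) with (N n - S (length l)) by lia.
      replace (fun l' => A n ((l ++ [w]) ++ l')) with (fun l' => A n (l ++ w :: l')).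
      + apply Hb; [exact Hg | lia |]. apply trans with w1; [apply Hw1 | apply (Hw 0)].
      + apply functional_extensionality. intro l'. rewrite <- app_assoc. reflexivity.
    - intros y Hy. apply In_nth with (d := d) in Hy as [n [_ <-]].
      apply trans with w2; [apply Hw2 | apply (Hw 1)]. }
  destruct (choice _ step) as [F HF]. destruct (course_of_values F) as [a Ha].
  exists a. split.
  - apply increasing_course_of_values with F; [intro l; apply HF | exact Ha].
  - assert (Hgood : forall m, good (map a (seq 0 m))).
    { induction m as [| m IH].
      - intros n _. simpl. rewrite Nat.sub_0_r. apply HA.
      - rewrite seq_S, map_app. simpl. rewrite Ha. apply HF, IH. }
    intros n Hn. apply (Hgood (N n) n); rewrite length_map, length_seq; [lia |].
    rewrite Nat.sub_diag. simpl. rewrite app_nil_r. exact Hn.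
Qed.

(** As [e n] sees only the bits before [n], it can be fed the finite list of earlier bits padded
    with [false]. *)
Lemma prefix_recursion (e : nat -> (nat -> bool) -> bool) :
  (forall n p q, (forall j, j < n -> p j = q j) -> e n p = e n q) ->
  exists x : nat -> bool, forall n, x n = e n x.
Proof.
  intro ext. destruct (course_of_values (fun l => e (length l) (fun j => nth j l false)))
    as [x Hx].
  exists x. intro n. rewrite Hx at 1. rewrite length_map, length_seq. apply ext.
  intros j Hj. rewrite (nth_indep _ _ (x 0)) by (rewrite length_map, length_seq; exact Hj).
  rewrite map_nth, seq_nth by exact Hj. reflexivity.
Qed.

(** * The graph and its uncountable chromatic number *)

Section Graph.

Context {W V : Type} (lt : W -> W -> Prop) (s : V -> nat -> W) (x : V -> nat -> bool).
Variable M : nat -> nat.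
Hypothesis lt_omega1 : omega1_order lt.
Hypothesis surj : forall a b, exists v, s v = a /\ x v = b.

Definition edge (u v : V) : Prop :=
  exists n, (forall j, j < n -> x u j = x v j) /\ x u n <> x v n /\
            linked lt (M n) (s u) (s v).

Lemma linked_sym m a b : linked lt m a b -> linked lt m b a.
Proof.
  intros (Ha & Hb & [H | H]); repeat split; auto.
Qed.

Lemma edge_simple : simple_graph edge.
Proof.
  split.
  - intros u v (n & Hj & Hn & Hl). exists n. split; [| split].
    + intros j H. symmetry. auto.
    + auto.
    + apply linked_sym, Hl.
  - intros u (n & _ & Hn & _). auto.
Qed.

(** Interlacing at depth at least one orders the first terms strictly, so first terms are a proper
    colouring by [W]. *)
Lemma edge_first_term u v : (forall n, 0 < M n) -> edge u v -> s u 0 <> s v 0.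
Proof.
  intros HM (n & _ & _ & _ & _ & [H | H]) E;
    destruct (H 0 (HM n)) as [H0 _]; simpl in H0; rewrite E in H0; exact (omega1_irrefl lt _ lt_omega1 H0).
Qed.

(* [trace c i n p e] lists the initial parts of the sequences of vertices of colour [i] whose
   bits start with [p 0, ..., p (n - 1), e]. *)
Definition trace (c : V -> nat) (i n : nat) (p : nat -> bool) (e : bool) (l : list W) : Prop :=
  exists v, c v = i /\ increasing lt (s v) /\ (forall j, j < n -> x v j = p j) /\
            x v n = e /\ l = map (s v) (seq 0 (2 * M n)).

(** Interlaced members of the two traces would come from vertices of equal colour whose bits first
    differ at [n], hence adjacent ones. *)
Lemma trace_not_both_large c i n p :
  proper_coloring edge c ->
  large lt (2 * M n) (trace c i n p true) -> large lt (2 * M n) (trace c i n p false) -> False.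
Proof.
  intros Hc HT HF.
  destruct (omega1_inhabited lt lt_omega1) as [d].
  replace (2 * M n) with (M n + M n) in HF at 1 by lia.
  destruct (large_interlaced lt d (M n) (M n) _ _ HT HF) as (la & lb & Hu & Hv & Hi).
  destruct Hu as (u & Hcu & Iu & Pu & Eu & ->). destruct Hv as (v & Hcv & Iv & Pv & Ev & ->).
  apply (Hc u v); [| congruence].
  exists n. split; [| split; [congruence | split; [exact Iu | split; [exact Iv | left]]]].
  - intros j Hj. rewrite Pu, Pv by exact Hj. reflexivity.
  - assert (nth_prefix : forall w j, j < 2 * M n -> nth j (map (s w) (seq 0 (2 * M n))) d = s w j).
    { intros w j Hj. rewrite (nth_indep _ _ (s w 0)) by (rewrite length_map, length_seq; exact Hj).
      rewrite map_nth, seq_nth by exact Hj. reflexivity. }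
    intros j Hj. specialize (Hi j Hj). rewrite !nth_prefix in Hi by lia. exact Hi.
Qed.

(* For each colour [n], the bits [x] are steered at position [n] to a side on which the
   colour class [n] is small; a sequence avoiding all these small sets has no colour. *)
Lemma edge_not_countably_colorable : ~ exists c : V -> nat, proper_coloring edge c.
Proof.
  intros [c Hc].
  destruct (prefix_recursion (fun n p =>
    if excluded_middle_informative (large lt (2 * M n) (trace c n n p true))
    then false else true)) as [b Hb].
  { intros n p q Hpq.
    replace (trace c n n q true) with (trace c n n p true); [reflexivity |].
    apply functional_extensionality. intro l. apply propositional_extensionality.
    split; intros (v & H1 & H2 & H3 & H4); exists v; repeat split; try assumption;
      try apply H4; intros j Hj; rewrite H3 by exact Hj; [| symmetry]; auto. }
  destruct (small_sets_avoidable lt (fun n => 2 * M n) (fun n => trace c n n b (b n)) lt_omega1)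
    as [a [Ia Ha]].
  { intros n H. pose proof (Hb n) as Hn. cbv beta in Hn.
    destruct (excluded_middle_informative _) as [Ht | Hf]; rewrite Hn in H; [| exact (Hf H)].
    exact (trace_not_both_large c n n b Hc Ht H). }
  destruct (surj a b) as [v [Es Ex]]. apply (Ha (c v)). exists v.
  rewrite Es, Ex. auto.
Qed.

(** * Colouring small subgraphs *)

Fixpoint bits_code (n : nat) (b : nat -> bool) : nat :=
  match n with 0 => 0 | S n => 2 * bits_code n b + Nat.b2n (b n) end.

Lemma bits_code_lt n b : bits_code n b < 2 ^ n.
Proof.
  induction n as [| n IH]; simpl; [lia | destruct (b n); simpl; lia].
Qed.

Lemma bits_code_inj n b b' : bits_code n b = bits_code n b' -> forall j, j < n -> b j = b' j.
Proof.
  induction n as [| n IH]; simpl; intros E j Hj; [lia |].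
  destruct (Nat.eq_dec j n) as [-> | N].
  - destruct (b n), (b' n); simpl in E; (reflexivity || lia).
  - apply IH; [destruct (b n), (b' n); simpl in E; lia | lia].
Qed.

Lemma edge_finite_colorable n (l : list V) (E' : V -> V -> Prop) :
  (forall m, n <= m -> 2 ^ (2 * length l + 1) <= M m) ->
  subgraph_of edge l E' -> colorable_with E' l (2 ^ (n + 1)).
Proof.
  intros HM [_ HE].
  (* [S] contains every edge inside [l] with first difference at least [n], and one bit colours it;
     the first [n] bits separate the ends of all other edges. *)
  set (S := fun u v => In u l /\ In v l /\ linked lt (2 ^ (2 * length l + 1)) (s u) (s v)).
  destruct lt_omega1 as [_ [trans _]].
  destruct (linked_two_colorable lt (fun w => omega1_irrefl lt w lt_omega1) trans S s l
              (2 ^ (2 * length l + 1))) as [c Hc].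
  - intros u v (Hu & Hv & H). split; [exact Hv | split; [exact Hu | apply linked_sym, H]].
  - intros u v (Hu & Hv & _). auto.
  - intros u v (_ & _ & H). exact H.
  - lia.
  - exists (fun v => 2 * bits_code n (x v) + Nat.b2n (c v)). split.
    + intros v _. pose proof (bits_code_lt n (x v)). rewrite Nat.pow_add_r.
      destruct (c v); simpl; lia.
    + intros u v Huv Ecol. destruct (HE u v Huv) as ((m & Hj & Hm & Iu & Iv & Hl) & Hu & Hv).
      assert (Ec : c u = c v) by (destruct (c u), (c v); simpl in Ecol; (reflexivity || lia)).
      assert (Eb : bits_code n (x u) = bits_code n (x v)) by (rewrite Ec in Ecol; lia).
      destruct (Nat.le_gt_cases n m) as [Hnm | Hnm].
      * apply (Hc u v); [| exact Ec]. split; [exact Hu | split; [exact Hv |]].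
        split; [exact Iu | split; [exact Iv |]].
        specialize (HM m Hnm).
        destruct Hl as [Hl | Hl]; [left | right]; intros i Hi; apply Hl; lia.
      * apply Hm. exact (bits_code_inj n _ _ Eb m Hnm).
Qed.

End Graph.

(** * Coding the vertices and choosing the growth of [M] *)

Lemma list_sum_ge_term (l : list nat) n : In n l -> n <= list_sum l.
Proof.
  induction l as [| m l IH]; simpl; [tauto |]. intros [-> | H]; [lia | specialize (IH H); lia].
Qed.

(* The pair [(a, b)] is stored as the graph of [a], with [b n] kept in the parity of the
   second coordinate. *)
Lemma sequences_from_subsets (W : Type) (d : W) :
  exists (s : (W * nat -> bool) -> nat -> W) (x : (W * nat -> bool) -> nat -> bool),
    forall a b, exists v, s v = a /\ x v = b.
Proof.
  set (enc := fun (p : (nat -> W) * (nat -> bool)) (q : W * nat) =>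
    if excluded_middle_informative
         (exists n, fst q = fst p n /\ snd q = 2 * n + Nat.b2n (snd p n))
    then true else false).
  assert (enc_spec : forall p q, enc p q = true <->
            exists n, fst q = fst p n /\ snd q = 2 * n + Nat.b2n (snd p n)).
  { intros p q. unfold enc. destruct (excluded_middle_informative _); intuition discriminate. }
  assert (enc_inj : forall p p', enc p = enc p' -> p = p').
  { intros [a b] [a' b'] E.
    assert (H : forall n, a n = a' n /\ b n = b' n).
    { intro n. assert (T : enc (a, b) (a n, 2 * n + Nat.b2n (b n)) = true)
        by (apply enc_spec; exists n; auto).
      rewrite E in T. apply enc_spec in T. simpl in T. destruct T as (n' & Ea & Eb).
      assert (n = n') by (destruct (b n), (b' n'); simpl in Eb; lia). subst n'.
      split; [exact Ea | destruct (b n), (b' n); simpl in Eb; (reflexivity || lia)]. }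
    f_equal; apply functional_extensionality; apply H. }
  set (dec := fun v => epsilon (inhabits (fun _ : nat => d, fun _ : nat => true))
                         (fun p => enc p = v)).
  exists (fun v => fst (dec v)), (fun v => snd (dec v)). intros a b.
  exists (enc (a, b)).
  assert (E : dec (enc (a, b)) = (a, b)).
  { apply enc_inj. apply (epsilon_spec _ (fun p => enc p = enc (a, b))). eauto. }
  rewrite E. auto.
Qed.

Theorem theoremA :
  forall f : nat -> nat,
  exists (V : Type) (E : V -> V -> Prop) (W : Type),
    simple_graph E /\
    has_card_aleph1 W /\
    equinumerous V (W -> bool) /\
    chromatic_aleph1 E W /\
    (forall k : nat, 3 <= k ->
       forall (s : list V) (E' : V -> V -> Prop),
         subgraph_of E s E' -> length s < f k ->
         colorable_with E' s (k - 1)).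
Proof.
  intro f. destruct omega1_exists as (W & lt & Hlt).
  destruct (omega1_inhabited lt Hlt) as [d].
  destruct (sequences_from_subsets W d) as (s & x & surj).
  (* The sum bounds [f k] for all [k] up to and including [2 ^ (n + 2)]. *)
  set (F := fun n => list_sum (map f (seq 0 (2 ^ (n + 2) + 1)))).
  set (M := fun n => 2 ^ (2 * F n + 1)).
  exists (W * nat -> bool), (edge lt s x M), (W * nat)%type.
  split; [| split; [| split; [| split; [split |]]]].
  - apply edge_simple.
  - exists (lex_nat lt). apply omega1_lex_nat, Hlt.
  - exists (fun v => v). split; [auto | eauto].
  - exists (fun v => (s v 0, 0)). intros u v Huv E. injection E as E.
    revert E. apply (edge_first_term lt s x M Hlt u v); [| exact Huv].
    intro n. apply Nat.neq_0_lt_0, Nat.pow_nonzero. discriminate.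
  - apply edge_not_countably_colorable; assumption.
  - intros k Hk l E' HE Hl.
    destruct (Nat.log2_spec (k - 1)) as [Hlo Hhi]; [lia |].
    assert (Hn : 1 <= Nat.log2 (k - 1)) by (apply (Nat.log2_le_mono 2); lia).
    (* Then [2 ^ (n + 1) <= k - 1 < 2 ^ (n + 2)]: the colours suffice, and [f k] is a term of [F m]
       for every [m >= n]. *)
    set (n := Nat.log2 (k - 1) - 1).
    replace (Nat.log2 (k - 1)) with (n + 1) in * by lia.
    replace (S (n + 1)) with (n + 2) in Hhi by lia.
    destruct (edge_finite_colorable lt s x M Hlt n l E') as [c [Hc1 Hc2]]; [| exact HE |].
    + intros m Hm. unfold M. apply Nat.pow_le_mono_r; [discriminate |].
      assert (2 ^ (n + 2) <= 2 ^ (m + 2)) by (apply Nat.pow_le_mono_r; lia).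
      assert (f k <= F m) by (apply list_sum_ge_term, in_map, in_seq; lia).
      lia.
    + exists c. split; [| exact Hc2]. intros v Hv. specialize (Hc1 v Hv). lia.
Qed.
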